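(* Let the extent density $f_R$ of the bodies considered be supported on $[\frac{1}{\lambda},1]$ with $\lambda\in(1,\infty)$, continuous on that interval, and bounded there as $f_{\max}\ge f_R(r)\ge f_{\min}>0$. For a given extent density $f_R$ and a given relative root-mean-square (RMS) error $\tilde\varepsilon$ in the volume estimate $V_N$, the required number of samples $N$ increases linearly with the dimension $n$.
   Context: The extent of a body in $\mathbb{R}^n$ containing the origin, along a unit vector $\hat s\in S^{n-1}$ (the surface of the unit sphere), is the distance $r$ from the origin to the surface of the body in that direction, i.e. $r\hat s$ lies on the surface. The extent density $f_R$ is the probability density function of the extent $R$ obtained when $\hat s$ is sampled uniformly on $S^{n-1}$. The volume of the body is $V=v_n\,\mathbb{E}[R^n]$, where $v_n=\frac{\pi^{n/2}}{\Gamma(\frac n2+1)}$ is the volume of the $n$-dimensional unit sphere (ball). The Monte Carlo estimate of the volume from $N$ independent extent samples $R_1,\dots,R_N$ is $V_N=\frac{v_n}{N}\sum_{i=1}^N R_i^n$. Its relative RMS error is $\tilde\varepsilon=\frac{\sqrt{\operatorname{Var}[V_N]}}{V}=\frac{\sqrt{\operatorname{Var}[R^n]}}{\mathbb{E}[R^n]}\frac{1}{\sqrt N}$. The extent density is held fixed as $n$ varies. *)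

(* Defs.v *)
From mathcomp Require Import all_boot all_order all_algebra.
From mathcomp Require Import all_classical all_reals all_analysis.

Set Implicit Arguments.
Unset Strict Implicit.
Unset Printing Implicit Defensive.

Import Order.TTheory GRing.Theory Num.Theory.
Import numFieldNormedType.Exports.

Local Open Scope classical_set_scope.
Local Open Scope ring_scope.

(* The library norm on 'rV[R]_n is the sup norm, hence an explicit Euclidean
   norm; the two induce the same topology. *)
Definition enorm (R : realType) (n : nat) (x : 'rV[R]_n) : R :=
  Num.sqrt (\sum_(i < n) x 0 i ^+ 2).

Definition unit_sphere (R : realType) (n : nat) : set 'rV[R]_n :=
  [set x | enorm x = 1].

Definition surface (R : realType) (n : nat) (B : set 'rV[R]_n) : set 'rV[R]_n :=
  closure B `\` interior B.

Definition is_extent (R : realType) (n : nat) (B : set 'rV[R]_n)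
    (s : 'rV[R]_n) (r : R) : Prop :=
  0 <= r /\ surface B (r *: s).

(* The last clause is what makes "the" extent along a direction meaningful. *)
Definition is_body (R : realType) (n : nat) (B : set 'rV[R]_n) : Prop :=
  [/\ B 0,
      exists M : R, forall x, B x -> enorm x <= M &
      forall s, unit_sphere s -> exists! r : R, is_extent B s r].

Definition borel_set (R : realType) (n : nat) : set (set 'rV[R]_n) :=
  <<s @open 'rV[R]_n >>.

(* The uniform law on the sphere is its unique rotation-invariant Borel
   probability. *)
Definition uniform_direction (d : measure_display) (T : measurableType d)
    (R : realType) (P : probability T R) (n : nat) (S : T -> 'rV[R]_n) : Prop :=
  [/\ forall w, unit_sphere (S w),
      forall A, borel_set A -> measurable (S @^-1` A) &
      forall Q : 'M[R]_n, Q *m Q^T = 1%:M ->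
        forall A, borel_set A ->
          P (S @^-1` [set x | A (x *m Q)]) = P (S @^-1` A)].

Definition has_density (d : measure_display) (T : measurableType d)
    (R : realType) (P : probability T R) (X : {RV P >-> R}) (f : R -> R) : Prop :=
  forall A : set R, measurable A ->
    distribution P X A = (\int[lebesgue_measure]_(r in A) (f r)%:E)%E.

Definition mutually_independent (d : measure_display) (T : measurableType d)
    (R : realType) (P : probability T R) (X : nat -> {RV P >-> R}) : Prop :=
  forall (J : seq nat) (A : nat -> set R),
    uniq J -> (forall j, measurable (A j)) ->
    P (\big[setI/setT]_(j <- J) (X j @^-1` A j)) =
    (\prod_(j <- J) P (X j @^-1` A j))%E.

Definition Gamma (R : realType) (s : R) : R :=
  \int[lebesgue_measure]_(t in `]0, +oo[) (t `^ (s - 1) * expR (- t)).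

Definition ball_volume (R : realType) (n : nat) : R :=
  pi `^ (n%:R / 2) / Gamma (n%:R / 2 + 1).

Section Estimate.
Context (d : measure_display) (T : measurableType d) (R : realType)
  (P : probability T R) (n : nat).

Definition volume (Y : {RV P >-> R}) : R :=
  ball_volume R n * fine 'E_P[fun w => Y w ^+ n].

Definition volume_estimate (X : nat -> {RV P >-> R}) (N : nat) : T -> R :=
  fun w => ball_volume R n / N%:R * \sum_(i < N) X i w ^+ n.

(* The X i are identically distributed, so X 0 serves as the generic extent. *)
Definition relative_rms_error (X : nat -> {RV P >-> R}) (N : nat) : R :=
  Num.sqrt (fine 'V_P[volume_estimate X N]) / volume (X 0%N).

Definition required_samples (X : nat -> {RV P >-> R}) (eps : R) (N : nat) : Prop :=
  [/\ (0 < N)%N, relative_rms_error X N <= eps &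
      forall M, (0 < M)%N -> relative_rms_error X M <= eps -> (N <= M)%N].

(* Independent extents of B along uniformly sampled directions S i. *)
Definition extent_samples (B : set 'rV[R]_n) (S : nat -> T -> 'rV[R]_n)
    (X : nat -> {RV P >-> R}) : Prop :=
  [/\ forall i, uniform_direction P (S i),
      forall i w, is_extent B (S i w) (X i w) &
      mutually_independent X].

End Estimate.

(* Main.v *)
Require Import Defs.
From mathcomp Require Import all_boot all_order all_algebra.
From mathcomp Require Import all_classical all_reals all_analysis.
From mathcomp Require Import measurable_realfun.
From mathcomp Require Import ring lra zify.

Set Implicit Arguments.
Unset Strict Implicit.
Unset Printing Implicit Defensive.

Import Order.TTheory GRing.Theory Num.Theory.
Import numFieldNormedType.Exports.

Local Open Scope classical_set_scope.
Local Open Scope ring_scope.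

(** Let a n be the expectation of R ^ n, that is, the integral of r ^ n f(r) over
    [1 / lambda, 1]. Independence makes the variance of the average of M samples
    equal to 1 / M times the variance of one sample, so the error is at most eps
    exactly when M >= v n, where v n = (a (2 n) / a n ^ 2 - 1) / eps ^ 2
    ([relative_rms_error_le]). Hence the required number of samples is the
    least positive integer that is at least v n; it depends on f, eps and n only.

    It is nondecreasing in n because the moments are log-convex
    ([moment_log_convex]), which makes a (2 n) / a n ^ 2 nondecreasing.

    It grows linearly because, as n grows, the weight n r ^ n concentrates at
    r = 1, so n a n tends to f 1 > 0 ([moment_asymptotic]). Therefore
    a (2 n) / (n a n ^ 2) = (2 n a (2 n)) / (2 (n a n) ^ 2) tends to
    1 / (2 f 1), and the number of samples divided by n tends to
    1 / (2 f 1 eps ^ 2).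

    The other ingredients are the transfer of expectations to the density
    ([has_density_ge0_expectation]), the product rule for the expectation under
    independence ([independent_ge0_expectationM]), and the fact that the ball
    volume is nonzero ([ball_volume_gt0]), so that it cancels from the relative
    error. *)

(** * Positivity of the volume of the ball *)

(** From ln x < x applied to x = t / c with c = 2 (a + 1): then
    a * ln t <= a * ln c + a t / c, and a / c <= 1 / 2. *)
Lemma powR_le_expR_half (R : realType) (a : R) : 0 <= a ->
  exists2 C : R, 0 <= C & forall t, 0 < t -> t `^ a <= C * expR (t / 2).
Proof.
move=> a0; pose c := 2 * (a + 1).
have c0 : 0 < c by rewrite /c; lra.
exists (expR (a * ln c)); first exact: expR_ge0.
move=> t t0; rewrite /powR gt_eqF// -expRD ler_expR.
have -> : ln t = ln c + ln (t / c).
  by rewrite -lnM ?posrE ?divr_gt0// mulrC divfK ?gt_eqF.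
rewrite mulrDr lerD2l.
have tc : 0 < t / c by rewrite divr_gt0.
apply: (@le_trans _ _ (a * (t / c))).
  by rewrite ler_wpM2l// ltW// ln_sublinear.
have : (t / c) * (2 * (a + 1)) = t by rewrite divfK ?gt_eqF.
nra.
Qed.

(** Finiteness matters as much as positivity: the real-valued integral of a
    function with infinite integral is zero. The integrand is dominated by a
    multiple of the density of the exponential law of rate 1/2, and is at least
    exp (-2) on [1, 2]. *)
Lemma Gamma_gt0 (R : realType) (s : R) : 1 <= s -> 0 < Gamma s.
Proof.
move=> s1; pose g (t : R) := t `^ (s - 1) * expR (- t).
have g0 t : 0 <= g t by rewrite mulr_ge0 ?powR_ge0 ?expR_ge0.
have mg : measurable_fun setT g.
  apply: measurable_funM; first exact: measurable_powR.
  by apply: measurableT_comp => //; exact: measurable_funP.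
pose I := (\int[lebesgue_measure]_(t in `]0%R, +oo[) (g t)%:E)%E.
have Ioo : (I < +oo)%E.
  have [|C C0 hC] := @powR_le_expR_half R (s - 1); first by lra.
  have h0 : 0 < 2^-1 :> R by rewrite invr_gt0.
  have mp : measurable_fun setT (exponential_pdf (2^-1 : R)).
    exact: measurable_exponential_pdf.
  apply: (@le_lt_trans _ _ (\int[lebesgue_measure]_(t in `]0%R, +oo[)
      ((C * 2) * exponential_pdf 2^-1 t)%:E)%E).
    apply: ge0_le_integral => //=.
    - by move=> t _; rewrite lee_fin.
    - by apply/measurable_EFinP; exact: measurable_funTS.
    - by apply/measurable_EFinP; apply: measurable_funTS; exact: measurable_funM.
    - move=> t; rewrite in_itv/= andbT => t0; rewrite lee_fin.
      rewrite exponential_pdfE ?(ltW t0)//.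
      have -> : C * 2 * (2^-1 * expR (- 2^-1 * t)) =
          C * expR (t / 2) * expR (- t).
        rewrite -!mulrA -expRD mulrA mulrA -(mulrA C) divff// mulr1.
        by congr (_ * expR _); lra.
      by apply: ler_wpM2r; [exact: expR_ge0|exact: hC].
  apply: (@le_lt_trans _ _ (\int[lebesgue_measure]_t
      ((C * 2) * exponential_pdf 2^-1 t)%:E)%E).
    apply: ge0_subset_integral => //.
    - by apply/measurable_EFinP; exact: measurable_funM.
    - move=> t _; rewrite lee_fin mulr_ge0 ?mulr_ge0//.
      by rewrite exponential_pdf_ge0// ltW.
  under eq_integral do rewrite EFinM.
  rewrite ge0_integralZl//=.
  - by rewrite integral_exponential_pdf// mule1 ltry.
  - exact/measurable_EFinP.
  - by move=> t _; rewrite lee_fin exponential_pdf_ge0// ltW.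
  - by rewrite lee_fin mulr_ge0.
rewrite /Gamma /Rintegral -/I.
suff I0 : (0 < I)%E by rewrite fine_gt0// I0.
apply: (@lt_le_trans _ _ (\int[lebesgue_measure]_(t in `[1%R, 2%R])
  (expR (- 2) : R)%:E)%E).
  rewrite integral_cst//= lebesgue_measure_itv/= lte_fin ltr1n.
  by rewrite -EFinD -EFinM lte_fin mulr_gt0 ?expR_gt0//; lra.
apply: (@le_trans _ _ (\int[lebesgue_measure]_(t in `[1%R, 2%R]) (g t)%:E)%E).
  apply: ge0_le_integral => //=.
  - by apply/measurable_EFinP; exact: measurable_funTS.
  - move=> t; rewrite in_itv/= => /andP[t1 t2]; rewrite lee_fin /g.
    rewrite -[leLHS]mul1r ler_pM ?expR_ge0 ?ler_expR ?lerN2//.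
    by rewrite -[leLHS](powRr0 t) ler_powR//; lra.
apply: ge0_subset_integral => //=.
- by apply/measurable_EFinP; exact: measurable_funTS.
- by move=> t _; rewrite lee_fin.
- move=> t /=; rewrite !in_itv/= andbT => /andP[t1 _]; exact: lt_le_trans t1.
Qed.

(** The relative error is a quotient by a multiple of the ball volume, which has
    to be nonzero in order to cancel. *)
Lemma ball_volume_gt0 (R : realType) (n : nat) : 0 < ball_volume R n.
Proof.
rewrite divr_gt0 ?powR_gt0 ?pi_gt0// Gamma_gt0//.
by rewrite lerDr divr_ge0.
Qed.

(** * Densities and independence *)

(** The density f and the Radon-Nikodym derivative of the law of X have the same
    integral over every Borel set, hence agree almost everywhere; the claim is
    then the change of variables for the latter. *)
Lemma has_density_ge0_expectation (d : measure_display)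
    (T : measurableType d) (R : realType) (P : probability T R)
    (X : {RV P >-> R}) (f : R -> R) (g : R -> \bar R) :
    has_density X f -> measurable_fun setT f -> (forall r, 0 <= f r) ->
    measurable_fun setT g -> (forall r, 0 <= g r)%E ->
  (\int[P]_w g (X w) = \int[lebesgue_measure]_r (g r * (f r)%:E))%E.
Proof.
move=> Xf mf f0 mg g0.
(* The Lebesgue measure lives on the copy measurableTypeR R of R, so the law
   of X has to be transported there before the two can be compared. *)
have mX : measurable_fun setT (X : T -> measurableTypeR R).
  exact: (@measurable_funPT _ _ _ _ X).
pose X' : {mfun T >-> measurableTypeR R} :=
  MeasurableFun.Pack (MeasurableFun.Class (isMeasurableFun.Build _ _ _ _ _ mX)).
pose nu : probability (measurableTypeR R) R := distribution P X'.
pose mu : {sigma_finite_measure set (measurableTypeR R) -> \bar R} :=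
  @lebesgue_measure R.
have nuE A : measurable A -> nu A = (\int[mu]_(r in A) (f r)%:E)%E.
  exact: Xf.
have numu : nu `<< mu.
  apply/null_content_dominatesP => A mA muA.
  rewrite nuE//.
  by rewrite null_set_integral//; apply/measurable_EFinP; exact: measurable_funTS.
have <- : (\int[nu]_r g r = \int[P]_w g (X w))%E.
  exact: ge0_integral_distribution.
rewrite -(Radon_Nikodym_SigmaFinite.change_of_variables numu)//.
apply: ae_eq_integral => //.
- apply: emeasurable_funM => //.
  exact: measurable_int (Radon_Nikodym_SigmaFinite.f_integrable numu).
- by apply: emeasurable_funM => //; exact/measurable_EFinP.
- apply: ae_eqe_mul2l; apply: integral_ae_eq => //.
  + exact: Radon_Nikodym_SigmaFinite.f_integrable.
  + exact/measurable_EFinP.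
  + by move=> E _ mE; rewrite -Radon_Nikodym_SigmaFinite.f_integral// -nuE.
Qed.

(** Independence says that the joint law of (X, Y) agrees with the product of the
    two laws on rectangles, so the two coincide, and Tonelli's theorem splits the
    integral. *)
Lemma independent_ge0_expectationM (d : measure_display)
    (T : measurableType d) (R : realType) (P : probability T R)
    (X Y : {RV P >-> R}) (g h : R -> \bar R) :
    (forall A B : set R, measurable A -> measurable B ->
      P (X @^-1` A `&` Y @^-1` B) = P (X @^-1` A) * P (Y @^-1` B))%E ->
    measurable_fun setT g -> (forall r, 0 <= g r)%E ->
    measurable_fun setT h -> (forall r, 0 <= h r)%E ->
  (\int[P]_w (g (X w) * h (Y w)) =
   \int[P]_w g (X w) * \int[P]_w h (Y w))%E.
Proof.
move=> indep mg g0 mh h0.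
pose Z w := (X w, Y w).
have mZ : measurable_fun setT Z by exact/measurable_fun_pair.
pose mZ' := MeasurableFun.Pack (MeasurableFun.Class (isMeasurableFun.Build _ _ _ _ _ mZ)).
pose m1 : probability _ R := distribution P X.
pose m2 : probability _ R := distribution P Y.
pose F (z : R * R) := (g z.1 * h z.2)%E.
have mF : measurable_fun setT F.
  by apply: emeasurable_funM; apply: measurableT_comp.
have F0 z : (0 <= F z)%E by rewrite mule_ge0.
transitivity (\int[distribution P mZ']_z F z)%E.
  by rewrite ge0_integral_distribution.
transitivity (\int[m1 \x m2]_z F z)%E.
  apply: eq_measure_integral => A mA _.
  apply/esym/product_measure_unique => [B C mB mC|]; last exact: mA.
  exact: indep.
rewrite fubini_tonelli1// /fubini_F/=.
under eq_integral => x _ do rewrite /F/= ge0_integralZl//.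
rewrite ge0_integralZr//; last exact: integral_ge0.
by rewrite !ge0_integral_distribution.
Qed.

(** * Variance of an average of uncorrelated variables *)

Lemma Lfun2_of_integral_sqr_lty (d : measure_display) (T : measurableType d)
    (R : realType) (P : probability T R) (Y : T -> R) :
    measurable_fun setT Y -> (\int[P]_w (Y w ^+ 2)%:E < +oo)%E ->
  Y \in Lfun P 2%:E.
Proof.
move=> mY Yoo; rewrite inE; apply/andP; split; rewrite inE//=.
rewrite /finite_norm unlock /Lnorm poweR_lty//.
by under eq_integral => w _ do
  rewrite /= powR_mulrn// real_normK ?num_real//.
Qed.

Lemma variance_sum_uncorrelated (d : measure_display) (T : measurableType d)
    (R : realType) (P : probability T R) (Y : nat -> T -> R) :
    (forall i, Y i \in Lfun P 2%:E) ->
    (forall i j, i != j -> covariance P (Y i) (Y j) = 0%E) ->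
  forall M, ('V_P[(fun w => (\sum_(i < M) Y i w)%R)] = \sum_(i < M) 'V_P[Y i])%E.
Proof.
move=> Y2 cov0 M.
have S2 k : (fun w => \sum_(i < k) Y i w) \in Lfun P 2%:E.
  elim: k => [|k IH].
    under eq_fun do rewrite big_ord0.
    exact: Lfun_cst.
  rewrite (_ : (fun _ => _) = (fun w => \sum_(i < k) Y i w) + Y k).
    by rewrite rpredD// lee1n.
  by apply/funext => w /=; rewrite big_ord_recr.
elim: M => [|M IH].
  under eq_fun do rewrite big_ord0.
  by rewrite big_ord0 variance_cst.
rewrite (_ : (fun _ => _) = (fun w => \sum_(i < M) Y i w) \+ Y M); last first.
  by apply/funext => w /=; rewrite big_ord_recr.
rewrite varianceD// IH big_ord_recr/=.
have cov_partial k : (k <= M)%N ->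
    covariance P (fun w => \sum_(i < k) Y i w) (Y M) = 0%E.
  elim: k => [_|k IHk kM].
    under eq_fun do rewrite big_ord0.
    exact: covariance_cst_l.
  rewrite (_ : (fun _ => _) = (fun w => \sum_(i < k) Y i w) \+ Y k); last first.
    by apply/funext => w /=; rewrite big_ord_recr.
  rewrite covarianceDl// IHk ?(ltnW kM)// cov0 ?adde0//.
  by rewrite neq_ltn kM.
by rewrite cov_partial// mule0 adde0.
Qed.

Lemma variance_sample_mean (d : measure_display) (T : measurableType d)
    (R : realType) (P : probability T R) (Y : nat -> T -> R) (v c : R) :
    (forall i, Y i \in Lfun P 2%:E) ->
    (forall i j, i != j -> covariance P (Y i) (Y j) = 0%E) ->
    (forall i, 'V_P[Y i] = v%:E)%E ->
  forall M, (0 < M)%N ->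
  ('V_P[(fun w => (c / M%:R * \sum_(i < M) Y i w)%R)] =
    (c ^+ 2 * v / M%:R)%:E)%E.
Proof.
move=> Y2 cov0 Yv M M0.
have S2 : (fun w => \sum_(i < M) Y i w) \in Lfun P 2%:E.
  rewrite (_ : (fun _ => _) = \sum_(i < M) Y i); last first.
    by apply/funext => w; rewrite fct_sumE.
  by rewrite rpred_sum// lee1n.
rewrite (_ : (fun _ => _) = (c / M%:R) \o* (fun w => \sum_(i < M) Y i w)); last first.
  by apply/funext => w /=; rewrite mulrC.
rewrite varianceZ// variance_sum_uncorrelated//.
under eq_bigr do rewrite Yv.
rewrite sumEFin sumr_const card_ord -EFinM -mulr_natr; congr EFin.
have : M%:R != 0 :> R by rewrite pnatr_eq0 -lt0n.
by move=> ?; field.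
Qed.

(** * Moments of the extent density *)

Lemma integrable_EFinZ (d : measure_display) (T : measurableType d)
    (R : realType) (mu : {measure set T -> \bar R}) (D : set T) (t : R)
    (f : T -> R) :
    measurable D -> mu.-integrable D (EFin \o f) ->
  mu.-integrable D (EFin \o (fun x => t * f x)).
Proof. by move=> mD fi; have := integrableZl mD t fi; exact. Qed.

Lemma integrable_EFinD (d : measure_display) (T : measurableType d)
    (R : realType) (mu : {measure set T -> \bar R}) (D : set T)
    (f g : T -> R) :
    measurable D -> mu.-integrable D (EFin \o f) ->
    mu.-integrable D (EFin \o g) ->
  mu.-integrable D (EFin \o (fun x => f x + g x)).
Proof. by move=> mD fi gi; have := integrableD mD fi gi; exact. Qed.

Lemma integrable_EFinB (d : measure_display) (T : measurableType d)
    (R : realType) (mu : {measure set T -> \bar R}) (D : set T)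
    (f g : T -> R) :
    measurable D -> mu.-integrable D (EFin \o f) ->
    mu.-integrable D (EFin \o g) ->
  mu.-integrable D (EFin \o (fun x => f x - g x)).
Proof. by move=> mD fi gi; have := integrableB mD fi gi; exact. Qed.

Section ExtentMoments.
Context (R : realType) (b fmin fmax : R) (f : R -> R).
Hypotheses (b0 : 0 < b) (b1 : b < 1) (fmin0 : 0 < fmin).
Hypothesis fcont : {within `[b, 1], continuous f}.
Hypothesis fbound : forall r, `[b, 1]%classic r -> fmin <= f r <= fmax.

(** For an extent with density f, this is the expectation of its k-th power. *)
Definition moment (k : nat) : R :=
  \int[lebesgue_measure]_(r in `[b, 1]) (r ^+ k * f r).

Lemma integrable_mul_density (p : R -> R) : continuous p ->
  lebesgue_measure.-integrable `[b, 1] (EFin \o (fun r => p r * f r)).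
Proof.
move=> cp; apply: continuous_compact_integrable; first exact: segment_compact.
have cp' : {within `[b, 1], continuous p} by exact: continuous_subspaceT.
by move=> x; apply: cvgM; [exact: cp'|exact: fcont].
Qed.

Lemma integrable_exprn (k : nat) :
  lebesgue_measure.-integrable `[b, 1] (EFin \o (fun r : R => r ^+ k)).
Proof.
apply: continuous_compact_integrable; first exact: segment_compact.
by apply: continuous_subspaceT => x; exact: exprn_continuous.
Qed.

Lemma moment_gt0 (k : nat) : 0 < moment k.
Proof.
apply: (@lt_le_trans _ _ (b ^+ k * fmin * (1 - b))).
  by rewrite !mulr_gt0 ?exprn_gt0// subr_gt0.
have <- : \int[lebesgue_measure]_(r in `[b, 1]) (b ^+ k * fmin)
    = b ^+ k * fmin * (1 - b).
  rewrite Rintegral_cst//= lebesgue_measure_itv/= lte_fin b1.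
  by rewrite -EFinD.
apply: le_Rintegral => //.
- apply: continuous_compact_integrable; first exact: segment_compact.
  by apply: continuous_subspaceT => x; exact: cvg_cst.
- by apply: integrable_mul_density => x; exact: exprn_continuous.
- move=> r /[dup] rb; rewrite /= in_itv/= => /andP[br r1].
  have /andP[f0 _] := fbound rb.
  apply: ler_pM => //; [by rewrite exprn_ge0// ltW|exact: ltW|].
  by rewrite lerXn2r// nnegrE ltW// (lt_le_trans b0).
Qed.

(** Cauchy-Schwarz: the integral of r ^ k (r - c) ^ 2 f(r) is nonnegative for
    every c, in particular for the minimizer c = moment k.+1 / moment k. *)
Lemma moment_log_convex (k : nat) :
  moment k.+1 ^+ 2 <= moment k * moment k.+2.
Proof.
pose c := moment k.+1 / moment k.
have ik j := @integrable_mul_density _ (@exprn_continuous R j).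
have ik' j t : lebesgue_measure.-integrable `[b, 1]
    (EFin \o (fun r => t * (r ^+ j * f r))).
  exact: integrable_EFinZ.
have : 0 <= moment k.+2 + - 2 * c * moment k.+1 + c ^+ 2 * moment k.
  rewrite -!RintegralZl// -!RintegralD//; last first.
    exact: integrable_EFinD.
  apply: Rintegral_ge0 => r /[dup] rb; rewrite /= in_itv/= => /andP[br r1].
  have -> : r ^+ k.+2 * f r + - 2 * c * (r ^+ k.+1 * f r) +
     c ^+ 2 * (r ^+ k * f r) = r ^+ k * (r - c) ^+ 2 * f r.
    by rewrite !exprS; ring.
  have /andP[f0 _] := fbound rb.
  have r0 : 0 <= r by rewrite (le_trans _ br)// ltW.
  have fr0 : 0 <= f r by rewrite (le_trans _ f0)// ltW.
  by rewrite mulr_ge0// mulr_ge0 ?sqr_ge0 ?exprn_ge0.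
have a0 := moment_gt0 k; rewrite /c => h.
have -> : moment k * moment k.+2 = moment k.+1 ^+ 2 + moment k *
  (moment k.+2 + - 2 * (moment k.+1 / moment k) * moment k.+1 +
     (moment k.+1 / moment k) ^+ 2 * moment k).
  by field; rewrite gt_eqF.
by rewrite lerDl mulr_ge0// ltW.
Qed.

(** By log-convexity the ratios q k = moment k.+1 / moment k are nondecreasing.
    Passing from n to n.+1 multiplies moment n.*2 / moment n ^+ 2 by
    q n.*2.+1 * q n.*2 / q n ^+ 2, a factor that is at least 1. *)
Lemma moment_ratio_nondecreasing (n : nat) :
  moment n.*2 / moment n ^+ 2 <= moment n.+1.*2 / moment n.+1 ^+ 2.
Proof.
have a0 := moment_gt0.
pose q k := moment k.+1 / moment k.
have q0 k : 0 < q k by rewrite divr_gt0.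
have q_nd : {homo q : i j / (i <= j)%N >-> i <= j}.
  apply: homo_leq => // [? ? ?|k]; first exact: le_trans.
  rewrite /q ler_pdivrMr// mulrAC ler_pdivlMr//.
  by rewrite -expr2 mulrC moment_log_convex.
have qE k : moment k.+1 = q k * moment k by rewrite divfK// gt_eqF.
rewrite doubleS !qE.
have -> : q n.*2.+1 * (q n.*2 * moment n.*2) / (q n * moment n) ^+ 2 =
    (q n.*2.+1 * q n.*2 / q n ^+ 2) * (moment n.*2 / moment n ^+ 2).
  by field; rewrite !gt_eqF.
apply: ler_peMl; first by rewrite ltW// divr_gt0// exprn_gt0.
rewrite ler_pdivlMr ?exprn_gt0// mul1r expr2.
by apply: ler_pM; [exact: ltW|exact: ltW|apply: q_nd; lia|apply: q_nd; lia].
Qed.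

Lemma Rintegral_exprn (n : nat) :
  \int[lebesgue_measure]_(r in `[b, 1]) r ^+ n =
    (1 - b ^+ n.+1) / n.+1%:R.
Proof.
have n0 : n.+1%:R != 0 :> R by rewrite pnatr_eq0.
rewrite /Rintegral (@continuous_FTC2 _ _ (fun r => r ^+ n.+1 / n.+1%:R))//=.
- by rewrite -mulrBl expr1n.
- by apply: continuous_subspaceT => x; exact: exprn_continuous.
- have cF : continuous (fun r : R => r ^+ n.+1 / n.+1%:R).
    move=> x; apply: cvgM; [exact: exprn_continuous|exact: cvg_cst].
  split.
  + by move=> x _; apply: derivableM => //; exact: exprn_derivable.
  + by apply: cvg_at_right_filter; exact: cF.
  + by apply: cvg_at_left_filter; exact: cF.
- move=> x _; rewrite derive1Mr; last exact: exprn_derivable.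
  by rewrite derive1E exp_derive/= ?scaler1 -[_ *: _]/(_ * _) mulrAC divff ?mul1r.
Qed.

Lemma natr_succ_ratio_cvg (k : nat) :
  (n%:R / (n + k).+1%:R : R) @[n --> \oo] --> (1 : R).
Proof.
have -> : (fun n => n%:R / (n + k).+1%:R : R) =
    (fun n => 1 - k.+1%:R * (n + k).+1%:R^-1).
  apply/funext => n; have : (n + k).+1%:R != 0 :> R by rewrite pnatr_eq0.
  by rewrite -addnS natrD => ?; field.
rewrite -[X in _ --> X]subr0; apply: cvgB; first exact: cvg_cst.
rewrite -(mulr0 k.+1%:R); apply: cvgM; first exact: cvg_cst.
have := @cvg_harmonic R; rewrite -(cvg_shiftn k).
exact: cvg_trans.
Qed.

Lemma power_integral_cvg (k : nat) :
  n%:R * (\int[lebesgue_measure]_(r in `[b, 1]) r ^+ (n + k)%N)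
    @[n --> \oo] --> (1 : R).
Proof.
have -> : (fun n => n%:R *
      (\int[lebesgue_measure]_(r in `[b, 1]) r ^+ (n + k)%N)) =
    (fun n => (1 - b ^+ (n + k.+1)%N) * (n%:R / (n + k).+1%:R)).
  by apply/funext => n; rewrite Rintegral_exprn addnS mulrCA.
rewrite -[X in _ --> X]mul1r; apply: cvgM; last exact: natr_succ_ratio_cvg.
rewrite -[X in _ --> X]subr0; apply: cvgB; first exact: cvg_cst.
have := @cvg_expr R b; rewrite ger0_norm ?ltW// => /(_ b1).
rewrite -(cvg_shiftn k.+1); exact: cvg_trans.
Qed.

(** Near 1 the left-hand side is at most e by continuity; at distance at least dl
    from 1 it is at most fmax, which K = fmax / dl absorbs. The affine form lets
    moment_asymptotic work on the whole interval, without cutting it. *)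
Lemma density_le_affine (e : R) : 0 < e ->
  exists2 K, 0 <= K & forall r, `[b, 1]%classic r ->
    `|f r - f 1| <= e + K * (1 - r).
Proof.
move=> e0.
have h1 : `[b, 1]%classic (1 : R) by rewrite /= in_itv/= lexx ltW.
have /subspace_continuousP/(_ _ h1)/cvgrPdist_le/(_ _ e0) := fcont.
rewrite near_withinE => /nbhs_ballP[dl /= dl0 hdl].
have /andP[f11 f12] := fbound h1.
have fmax0 : 0 <= fmax by rewrite (le_trans (ltW fmin0))// (le_trans f11).
exists (fmax / dl); first by rewrite divr_ge0// ltW.
move=> r rb; have /andP[fr1 fr2] := fbound rb.
move: (rb); rewrite /= in_itv/= => /andP[br r1].
have [rd|rd] := ltP (1 - r) dl.
  rewrite (@le_trans _ _ e)//.
    rewrite distrC; apply: hdl => //=.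
    by rewrite /ball/= ger0_norm// subr_ge0.
  by rewrite lerDl mulr_ge0 ?subr_ge0// divr_ge0// ltW.
have : fmax <= fmax / dl * (1 - r).
  by rewrite mulrAC ler_pdivlMr// ler_wpM2l.
move=> fmaxK; rewrite ler_norml; move: fmin0 => fm.
by apply/andP; split; lra.
Qed.

(** Write I n for the integral of r ^ n. The measure n r ^ n dr has mass n * I n,
    tending to 1, and concentrates at 1: by density_le_affine,
    n * |moment n - f 1 * I n| <= e * n * I n + K * (n * I n - n * I n.+1),
    and the last difference tends to 0 since both terms tend to 1. *)
Lemma moment_asymptotic : n%:R * moment n @[n --> \oo] --> f 1.
Proof.
pose I n := \int[lebesgue_measure]_(r in `[b, 1]) (r : R) ^+ n.
have h1 : `[b, 1]%classic (1 : R) by rewrite /= in_itv/= lexx ltW.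
have /andP[f1 _] := fbound h1.
apply/cvgrPdist_le => e e0.
have [|K K0 hK] := @density_le_affine (e / 4); first by rewrite divr_gt0.
have ir j t : lebesgue_measure.-integrable `[b, 1]
    (EFin \o (fun r : R => t * r ^+ j)).
  by apply: integrable_EFinZ => //; exact: integrable_exprn.
have ik j := @integrable_mul_density _ (@exprn_continuous R j).
have dist n : `|moment n - f 1 * I n| <=
    (e / 4) * I n + K * (I n - I n.+1).
  have iB : lebesgue_measure.-integrable `[b, 1]
      (EFin \o (fun r : R => r ^+ n * f r - f 1 * r ^+ n)).
    exact: integrable_EFinB.
  have -> : moment n - f 1 * I n =
      \int[lebesgue_measure]_(r in `[b, 1]) (r ^+ n * f r - f 1 * r ^+ n).
    by rewrite RintegralB// RintegralZl//; exact: integrable_exprn.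
  have -> : e / 4 * I n + K * (I n - I n.+1) =
      \int[lebesgue_measure]_(r in `[b, 1])
        ((e / 4 + K) * r ^+ n - K * r ^+ n.+1).
    rewrite RintegralB// !RintegralZl//; [|exact: integrable_exprn..].
    by rewrite /I; ring.
  apply: le_trans; first exact: le_normr_Rintegral.
  apply: le_Rintegral => //.
  - exact: (integrable_norm iB).
  - exact: integrable_EFinB.
  - move=> r rb; have := hK _ rb.
    move: (rb); rewrite /= in_itv/= => /andP[br r1] h.
    have rn : 0 <= r ^+ n by rewrite exprn_ge0// (le_trans (ltW b0)).
    rewrite (mulrC (f 1)) -mulrBr normrM (ger0_norm rn).
    have -> : (e / 4 + K) * r ^+ n - K * r ^+ n.+1 =
      r ^+ n * (e / 4 + K * (1 - r)) by rewrite exprS; ring.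
    exact: ler_wpM2l.
(* Errors of size eta on n * I n and n * I n.+1 cost at most
   eta * (f 1 + 2 * K), to be kept below e / 4; eta <= 1 gives n * I n <= 2. *)
pose eta := Num.min 1 (e / (4 * (f 1 + 2 * K + 1))).
have f10 : 0 < f 1 by exact: lt_le_trans f1.
have D0 : 0 < f 1 + 2 * K + 1 by lra.
have eta0 : 0 < eta by rewrite lt_min ltr01 divr_gt0// mulr_gt0.
have eta1 : eta <= 1 by rewrite ge_min lexx.
have eta2 : eta * (f 1 + 2 * K + 1) <= e / 4.
  have : eta <= e / (4 * (f 1 + 2 * K + 1)) by rewrite ge_min lexx orbT.
  rewrite ler_pdivlMr ?mulr_gt0//; lra.
have c0 := power_integral_cvg 0; have c1 := power_integral_cvg 1.
move/cvgrPdist_le/(_ _ eta0) : c0 => c0.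
move/cvgrPdist_le/(_ _ eta0) : c1 => c1.
near=> n.
have u1 : `|1 - n%:R * I n| <= eta.
  by near: n; apply: filterS c0 => n; rewrite addn0.
have v1 : `|1 - n%:R * I n.+1| <= eta.
  by near: n; apply: filterS c1 => n; rewrite addn1.
have n0 : 0 <= n%:R :> R by [].
have := ler_wpM2l n0 (dist n).
rewrite -[X in X * `|_|](ger0_norm n0) -normrM.
have -> : n%:R * (moment n - f 1 * I n) = n%:R * moment n - f 1 * (n%:R * I n).
  by ring.
have -> : n%:R * (e / 4 * I n + K * (I n - I n.+1)) =
    e / 4 * (n%:R * I n) + K * (n%:R * I n - n%:R * I n.+1) by ring.
move: u1 v1; move: (n%:R * I n) (n%:R * I n.+1) (n%:R * moment n) => u v a.
rewrite !ler_norml => /andP[u1 u2] /andP[v1 v2] /andP[a1 a2].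
have Kuv : K * (u - v) <= K * (2 * eta) by apply: ler_wpM2l => //; lra.
have fu1 : f 1 * (1 - u) <= f 1 * eta by apply: ler_wpM2l => //; exact: ltW.
have fu2 : f 1 * - eta <= f 1 * (1 - u) by apply: ler_wpM2l => //; exact: ltW.
have eu : e / 4 * u <= e / 4 * 2 by apply: ler_wpM2l; lra.
by apply/andP; split; lra.
Unshelve. all: by end_near. Qed.
End ExtentMoments.

(** * Rounding up to a number of samples *)

Lemma natr_inv_cvg0 (R : realType) :
  (n%:R^-1 : R) @[n --> \oo] --> (0 : R).
Proof. by rewrite -(cvg_shiftS (fun n => n%:R^-1 : R)); exact: cvg_harmonic. Qed.

Section SampleCount.
Context (R : realType).
Implicit Types v w : R.

(** The maximum makes the count positive when v = 0: zero samples do not give an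
    estimate. *)
Definition sample_count v : nat := maxn 1 `|Num.ceil v|%N.

Lemma sample_count_le v (M : nat) : 0 <= v -> (0 < M)%N ->
  (sample_count v <= M)%N = (v <= M%:R).
Proof.
move=> v0 M0; rewrite geq_max M0/= -lez_nat gez0_abs ?ceil_ge0//; last first.
  by rewrite (lt_le_trans _ v0)// ltrN10.
by rewrite ceil_le_int.
Qed.

Lemma le_sample_count v : 0 <= v -> v <= (sample_count v)%:R.
Proof. by move=> v0; rewrite -sample_count_le// leq_max. Qed.

Lemma sample_count_le_add1 v : 0 <= v -> (sample_count v)%:R <= v + 1.
Proof.
move=> v0; rewrite /sample_count; case: leqP => _; last by rewrite lerDr.
rewrite natr_absz ger0_norm ?ceil_ge0 ?(lt_le_trans _ v0) ?ltrN10//.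
by have := ceilB1_lt v; rewrite rmorphB/= ltrBlDr => /ltW.
Qed.

Lemma sample_count_nondecreasing v w : v <= w -> 0 <= v ->
  (sample_count v <= sample_count w)%N.
Proof.
move=> vw v0; have w0 := le_trans v0 vw.
by rewrite sample_count_le ?leq_max// (le_trans vw)// le_sample_count.
Qed.

Lemma sample_count_cvg (v : nat -> R) (c : R) :
    (forall n, 0 <= v n) ->
    v n / n%:R @[n --> \oo] --> c ->
  (sample_count (v n))%:R / n%:R @[n --> \oo] --> c.
Proof.
move=> v0 vc.
apply: (@squeeze_cvgr _ _ _ _ (fun n => v n / n%:R)
  (fun n => v n / n%:R + n%:R^-1)) => //.
  near=> n; rewrite -[X in _ + X]mul1r -mulrDl.
  by rewrite !ler_wpM2r ?invr_ge0 ?le_sample_count ?sample_count_le_add1.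
by rewrite -[X in _ --> X]addr0; apply: cvgD => //; exact: natr_inv_cvg0.
Unshelve. all: by end_near. Qed.
End SampleCount.

(** * The error of the volume estimate *)

Section ExtentRV.
Context (R : realType) (b fmin fmax : R) (f : R -> R).
Hypotheses (b0 : 0 < b) (b1 : b < 1) (fmin0 : 0 < fmin).
Hypothesis fsupp : forall r, ~ `[b, 1]%classic r -> f r = 0.
Hypothesis fcont : {within `[b, 1], continuous f}.
Hypothesis fbound : forall r, `[b, 1]%classic r -> fmin <= f r <= fmax.

Lemma density_ge0 r : 0 <= f r.
Proof.
have [rb|rb] := pselect (`[b, 1]%classic r); last by rewrite fsupp.
by have /andP[f0 _] := fbound rb; rewrite (le_trans _ f0)// ltW.
Qed.

Lemma density_restrict : f = f \_ `[b, 1].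
Proof.
apply/funext => r; rewrite patchE; case: ifPn => // /negP rb.
by apply: fsupp => rb'; apply: rb; rewrite inE.
Qed.

(** Only the continuity on [b, 1] is known; f is measurable on the line because it
    is the extension by zero of its restriction. *)
Lemma measurable_density : measurable_fun setT f.
Proof.
rewrite density_restrict; apply/(measurable_restrictT _ _).1 => //.
exact: subspace_continuous_measurable_fun.
Qed.

Context (d : measure_display) (T : measurableType d) (P : probability T R).

(** The transfer to the density needs a nonnegative integrand on the whole line,
    hence the detour through |r| ^ k. *)
Lemma extent_moment (X : {RV P >-> R}) (k : nat) :
    has_density X f -> (forall w, 0 <= X w) ->
  (\int[P]_w (X w ^+ k)%:E = (moment b f k)%:E)%E.
Proof.
move=> Xf X0.
have -> : (\int[P]_w (X w ^+ k)%:E = \int[P]_w (`|X w| ^+ k)%:E)%E.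
  by apply: eq_integral => w _; rewrite ger0_norm.
have mg : measurable_fun setT (fun r : R => (`|r| ^+ k)%:E).
  apply/measurable_EFinP; apply: measurable_funX; exact: normr_measurable.
rewrite (has_density_ge0_expectation Xf measurable_density density_ge0 mg);
  last by move=> r; rewrite lee_fin exprn_ge0.
rewrite /moment /Rintegral fineK; last first.
  by apply: integrable_fin_num => //; apply: (integrable_mul_density fcont) => x;
    exact: exprn_continuous.
rewrite [RHS]integral_mkcond; apply: eq_integral => r _.
rewrite patchE; case: ifPn => [|/negP rb].
  rewrite inE/= in_itv/= => /andP[br _].
  by rewrite -EFinM ger0_norm// (le_trans (ltW b0)).
by rewrite fsupp ?mule0// => rb'; apply: rb; rewrite inE.
Qed.

Context (X : nat -> {RV P >-> R}).
Hypothesis Xindep : mutually_independent X.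
Hypothesis Xdens : forall i, has_density (X i) f.
Hypothesis X0 : forall i w, 0 <= X i w.

Let Y n i : T -> R := fun w => X i w ^+ n.

Lemma extent_power_Lfun2 n i : Y n i \in Lfun P 2%:E.
Proof.
apply: Lfun2_of_integral_sqr_lty.
  by apply: measurable_funX; exact: (@measurable_funPT _ _ _ _ (X i)).
rewrite /Y; under eq_integral do rewrite -exprM.
by rewrite extent_moment// ltry.
Qed.

Lemma extent_power_expectation n i : ('E_P[Y n i] = (moment b f n)%:E)%E.
Proof. by rewrite unlock extent_moment. Qed.

Lemma extent_power_uncorrelated n i j : i != j ->
  covariance P (Y n i) (Y n j) = 0%E.
Proof.
move=> ij; have Pfin : P setT \is a fin_num := fin_num_measure P _ measurableT.
have Y2 k := extent_power_Lfun2 n k.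
have Y1 k := Lfun_subset12 Pfin (Y2 k).
rewrite covarianceE//; last exact: Lfun2_mul_Lfun1.
rewrite !extent_power_expectation -EFinM.
suff -> : ('E_P[Y n i * Y n j] = (moment b f n * moment b f n)%:E)%E.
  by rewrite subee.
have mg : measurable_fun setT (fun r : R => (`|r| ^+ n)%:E).
  apply/measurable_EFinP; apply: measurable_funX; exact: normr_measurable.
have g0 (r : R) : (0 <= (`|r| ^+ n)%:E)%E by rewrite lee_fin exprn_ge0.
have indep (A B : set R) : measurable A -> measurable B ->
    P (X i @^-1` A `&` X j @^-1` B) = (P (X i @^-1` A) * P (X j @^-1` B))%E.
  move=> mA mB.
  have := Xindep (J := [:: i; j]) (A := fun k => if k == i then A else B).
  rewrite /= inE ij => /(_ isT) H.
  have mAB k : measurable (if k == i then A else B) by case: ifP.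
  move: H => /(_ mAB).
  by rewrite !big_cons !big_nil eqxx eq_sym (negbTE ij) setIT mule1.
have := independent_ge0_expectationM indep mg g0 mg g0.
have nE k w : (`|X k w| ^+ n)%:E = (X k w ^+ n)%:E by rewrite ger0_norm.
under eq_integral do rewrite !nE -EFinM.
under [X in (X * _)%E]eq_integral do rewrite nE.
under [X in (_ * X)%E]eq_integral do rewrite nE.
by rewrite !extent_moment// -EFinM unlock => <-.
Qed.

Lemma extent_power_variance n i :
  ('V_P[Y n i] = (moment b f n.*2 - moment b f n ^+ 2)%:E)%E.
Proof.
rewrite varianceE ?extent_power_Lfun2// extent_power_expectation.
rewrite unlock.
under eq_integral do rewrite /Y fctE -exprM muln2.
by rewrite extent_moment// -EFin_expe -EFinB.
Qed.

(** The squared relative error is (moment n.*2 / moment n ^+ 2 - 1) / M: the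
    variance of an average of M uncorrelated terms is 1 / M times the variance of
    one term, and the squared ball volume cancels. *)
Lemma relative_rms_error_le (eps : R) (n M : nat) : 0 < eps -> (0 < M)%N ->
  (relative_rms_error n X M <= eps) =
    ((moment b f n.*2 / moment b f n ^+ 2 - 1) / eps ^+ 2 <= M%:R).
Proof.
move=> e0 M0; have v0 := ball_volume_gt0 R n.
have a0 := moment_gt0 b0 b1 fmin0 fcont fbound n.
rewrite /relative_rms_error /volume /volume_estimate.
rewrite [in X in Num.sqrt X](variance_sample_mean (Y := Y n) _
  (extent_power_Lfun2 n) (@extent_power_uncorrelated n)
  (extent_power_variance n))//.
have -> : fine 'E_P[fun w => X 0%N w ^+ n] = moment b f n.
  by rewrite (extent_power_expectation n 0).
rewrite /=.
rewrite (ler_pdivrMr _ _ (mulr_gt0 v0 a0)).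
set a2 := moment b f n.*2; set a := moment b f n; set v := ball_volume R n.
have t0 : 0 < eps * (v * a) by exact: mulr_gt0 e0 (mulr_gt0 v0 a0).
rewrite -(ger0_norm (ltW t0)) -sqrtr_sqr ler_sqrt ?sqr_ge0//.
have M0' : 0 < M%:R :> R by rewrite ltr0n.
rewrite ler_pdivrMr// [RHS]ler_pdivrMr ?exprn_gt0//.
rewrite lerBlDr ler_pdivrMr ?exprn_gt0//.
have v2 : 0 < v ^+ 2 by exact: exprn_gt0 v0.
have E : (eps * (v * a)) ^+ 2 * M%:R - v ^+ 2 * (a2 - a ^+ 2) =
    v ^+ 2 * ((M%:R * eps ^+ 2 + 1) * a ^+ 2) - v ^+ 2 * a2 by ring.
by rewrite -[RHS](ler_pM2l v2) -[LHS]subr_ge0 E subr_ge0.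
Qed.
End ExtentRV.

(** * Linear growth *)

(** With u n = n * a n, tending to c, the sequence equals
    (u n.*2 / 2) / (u n) ^ 2 - 1 / n for n > 0. *)
Lemma square_coefficient_of_variation_cvg (R : realType) (a : nat -> R)
    (c : R) : c != 0 -> (forall n, a n != 0) ->
    n%:R * a n @[n --> \oo] --> c ->
  (a n.*2 / a n ^+ 2 - 1) / n%:R @[n --> \oo] --> (2 * c)^-1.
Proof.
move=> c0 a0 ac.
have a2c : n.*2%:R * a n.*2 @[n --> \oo] --> c.
  apply: (cvg_comp _ (fun n => n%:R * a n) _ ac).
  apply/cvgnyPge => A; near=> n.
  rewrite -addnn (leq_trans _ (leq_addl _ _))//; near: n.
  exact: nbhs_infty_ge.
have invn := @natr_inv_cvg0 R.
have lim : (2^-1 * (n.*2%:R * a n.*2) / (n%:R * a n) ^+ 2 - n%:R^-1)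
    @[n --> \oo] --> 2^-1 * c / (c * c) - 0.
  apply: cvgB => //; apply: cvgM; first by apply: cvgM => //; exact: cvg_cst.
  apply: cvgV; first by rewrite mulf_neq0.
  exact: cvgM.
have -> : (2 * c)^-1 = 2^-1 * c / (c * c) - 0 by field.
apply: cvg_trans lim; apply: near_eq_cvg; near=> n.
have n0 : n%:R != 0 :> R.
  by rewrite pnatr_eq0 -lt0n; near: n; exact: nbhs_infty_gt.
by rewrite -muln2 natrM; field; rewrite n0 a0.
Unshelve. all: by end_near. Qed.

Theorem proposition4p3 (R : realType) (lambda fmin fmax eps : R) (f : R -> R)
    (hlambda : 1 < lambda) (hfmin : 0 < fmin) (heps : 0 < eps)
    (fsupp : forall r, ~ `[lambda^-1, 1]%classic r -> f r = 0)
    (fcont : {within `[lambda^-1, 1], continuous f})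
    (fbound : forall r, `[lambda^-1, 1]%classic r -> fmin <= f r <= fmax)
    (fdensity : (\int[lebesgue_measure]_r (f r)%:E = 1)%E) :
  exists N : nat -> nat,
    [/\ forall (n : nat) (B : set 'rV[R]_n)
          (d : measure_display) (T : measurableType d) (P : probability T R)
          (S : nat -> T -> 'rV[R]_n) (X : nat -> {RV P >-> R}),
          (2 <= n)%N -> is_body B -> extent_samples B S X ->
          (forall i, has_density (X i) f) ->
          required_samples n X eps (N n),
        forall m n : nat, (2 <= m)%N -> (m <= n)%N -> (N m <= N n)%N &
        exists2 c : R, 0 < c & (N n)%:R / n%:R @[n --> \oo] --> c].
Proof.
pose b := lambda^-1.
have l0 : 0 < lambda by lra.
have b0 : 0 < b by rewrite invr_gt0.
have b1 : b < 1 by rewrite invf_lt1.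
pose a := moment b f.
have a_gt0 : forall n, 0 < a n := moment_gt0 b0 b1 hfmin fcont fbound.
pose v n := (a n.*2 / a n ^+ 2 - 1) / eps ^+ 2.
have e2 : 0 < (eps ^+ 2)^-1 by rewrite invr_gt0 exprn_gt0.
have v_nd : {homo v : m n / (m <= n)%N >-> m <= n}.
  apply: homo_leq => // [? ? ?|n]; first exact: le_trans.
  rewrite ler_pM2r// lerD2r.
  exact: (moment_ratio_nondecreasing b0 b1 hfmin fcont fbound).
(* The zeroth moment is the total mass; with v_nd it gives 0 = v 0 <= v n. *)
have a0 : a 0%N = 1.
  rewrite /a /moment /Rintegral -[RHS]/(fine 1%E) -fdensity; congr fine.
  rewrite [LHS]integral_mkcond; apply: eq_integral => r _.
  rewrite patchE; case: ifPn => [_|/negP rb]; first by rewrite expr0 mul1r.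
  by rewrite fsupp// => rb'; apply: rb; rewrite inE.
have v0 n : 0 <= v n.
  rewrite (le_trans _ (v_nd 0%N n _))// /v double0 a0.
  by rewrite expr1n divr1 subrr mul0r.
exists (fun n => sample_count (v n)); split => /=.
- move=> n B d T P S X _ _ [_ XS Xindep] Xdens.
  have X0 i w : 0 <= X i w by have [] := XS i w.
  have rmsE := relative_rms_error_le b0 b1 hfmin fsupp fcont fbound Xindep Xdens
    X0 n heps.
  have N0 : (0 < sample_count (v n))%N by rewrite leq_max.
  split=> // [|M M0]; rewrite rmsE//.
    exact: (le_sample_count (v0 n)).
  by rewrite (sample_count_le (v0 n) M0).
- by move=> m n _ mn; apply: sample_count_nondecreasing; rewrite ?v_nd.
- have h1 : `[b, 1]%classic (1 : R) by rewrite /= in_itv/= lexx ltW.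
  have /andP[f1 _] := fbound _ h1; have f10 := lt_le_trans hfmin f1.
  exists ((2 * f 1)^-1 * (eps ^+ 2)^-1).
    by rewrite mulr_gt0// invr_gt0 mulr_gt0.
  apply: sample_count_cvg => //.
  have -> : (fun n => v n / n%:R) =
      (fun n => (a n.*2 / a n ^+ 2 - 1) / n%:R * (eps ^+ 2)^-1).
    by apply/funext => n; rewrite /v mulrAC.
  apply: cvgM; last exact: cvg_cst.
  apply: square_coefficient_of_variation_cvg; first by rewrite gt_eqF.
    by move=> n; rewrite gt_eqF.
  exact: (moment_asymptotic b0 b1 hfmin fcont fbound).
Qed.
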